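(* Let $G=\{x_0,x_1,\dots,x_{n-1}\}$ be a finite abelian group of order $n$ with neutral element $x_0=0$, and let $\widetilde M_G$ be its extended Cayley table. For non-negative integers $k_0,\dots,k_{n-1}$, the monomial $\prod_{i=0}^{n-1}x_i^{k_i}$ occurs in $\mathrm{per}(\widetilde M_G)$ if and only if $$\sum_{i=0}^{n-1}k_i=n+1\quad\text{and}\quad k_0x_0\dotplus k_1x_1\dotplus\dots\dotplus k_{n-1}x_{n-1}=0\in G.$$
   Context: The group operation of $G$ is denoted $\dotplus$, and $k_ix_i$ in the group equation means $x_i\dotplus\dots\dotplus x_i$ ($k_i$ times). The elements $x_0,\dots,x_{n-1}$ of $G$ are also regarded as independent variables of the polynomial ring $\mathbb C[x_0,\dots,x_{n-1}]$. Put $x_n:=x_0$ (the neutral element taken a second time). The extended Cayley table is the $(n+1)\times(n+1)$ matrix $\widetilde M_G=(m_{i,j})_{0\le i,j\le n}$ with $m_{i,j}=x_i\dotplus x_j$, i.e. the variable corresponding to the group element $x_i\dotplus x_j$. Its permanent is $\mathrm{per}(\widetilde M_G)=\sum_{\pi}\prod_{i=0}^{n}m_{i,\pi(i)}$, the sum over all permutations $\pi$ of $\{0,1,\dots,n\}$. A monomial occurs in a polynomial if its coefficient is nonzero. *)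

(* Defs.v *)
From mathcomp Require Import all_boot all_order all_fingroup all_algebra.
From mathcomp Require Import reals complex mpoly.

Set Implicit Arguments.
Unset Strict Implicit.
Unset Printing Implicit Defensive.

Import GRing.Theory.
Local Open Scope ring_scope.

Definition permanent (S : pzSemiRingType) (m : nat) (A : 'M[S]_m) : S :=
  \sum_(s : 'S_m) \prod_(i < m) A i (s i).

Section ExtendedCayleyTable.

Variables (C : nzRingType) (G : finZmodType) (n : nat).
Variables (n_gt0 : (0 < n)%N) (x : 'I_n -> G).

(* x_0, ..., x_{n-1}, x_n, with the convention x_n := x_0 *)
Definition extended_enum (i : 'I_n.+1) : G :=
  if unlift ord_max i is Some j then x j else x (Ordinal n_gt0).

(* The variable 'X_i such that x i = g; the default value 0 is never used when
   x is a bijection. *)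
Definition variable_of (g : G) : {mpoly C[n]} :=
  if [pick i | x i == g] is Some i then 'X_i else 0.

Definition extended_cayley_table : 'M[{mpoly C[n]}]_n.+1 :=
  \matrix_(i, j) variable_of (extended_enum i + extended_enum j).

End ExtendedCayleyTable.

Arguments extended_cayley_table C {G n} n_gt0 x.

(* Main.v *)
(* All coefficients of the permanent are natural numbers, so a monomial occurs
   as soon as one permutation produces it. The statement thus asks which
   families (c_0, ..., c_n) in G are rearrangements of the sums e_i + e_(s i),
   where e lists G with 0 repeated. Merging two members c, c' of the family
   into c + c' reduces this to M. Hall's theorem: every family d of |G|
   elements with sum 0 is of the form a + b with two enumerations a, b of G.
   After translating (a, b) to (a + w, b - w), the merged sum reads c + c', and
   using the two extra zeros it splits into c + 0 and 0 + c'.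
   Hall's theorem is proved by correcting one value of d at a time: in
   enumerations a, b with prescribed sums away from i0 and i1, the value at i0
   can be made arbitrary. Up to translating b, the required value is
   a_i0 + a_i1; the pairs {a_i, b_i} with i <> i0, i1, together with
   {a_i0, a_i1} and {b_i0, b_i1}, form a 2-regular multigraph, and orienting
   its cycles gives the new enumerations. *)
Require Import Defs.
From mathcomp Require Import all_boot all_order all_fingroup all_algebra.
From mathcomp Require Import reals complex mpoly.

Set Implicit Arguments.
Unset Strict Implicit.
Unset Printing Implicit Defensive.

Import GRing.Theory.
Local Open Scope ring_scope.

(* The edges are {i, s^-1 i}; walking along s from i1, the edges met before
   returning to {i0, i1} are reversed. *)
Lemma reorient_cycles (I : finType) (s : {perm I}) (i0 i1 : I) : i0 != i1 ->
  exists p q : {perm I}, [/\ p i0 = i0, q i0 = i1 &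
    forall i, i != i0 -> i != i1 ->
      p i = i /\ s (q i) = i \/ s (p i) = i /\ q i = i].
Proof.
move=> i01.
have ex_m : exists m, iter m.+1 s i1 \in pred2 i0 i1.
  exists #[s]%g.-1; rewrite prednK ?order_gt0 // -permX expg_order perm1.
  by rewrite !inE eqxx orbT.
case: (ex_minnP ex_m) => m sm_end m_min.
pose J := [set iter j.+1 s i1 | j : 'I_m].
pose e := iter m s i1.
have J0 i : i \in J -> i != i0 /\ i != i1.
  case/imsetP=> j _ ->; apply/andP; rewrite -negb_or; apply/negP => /m_min.
  by rewrite leqNgt ltn_ord.
have Ji0 : i0 \in J = false by apply/negP => iJ; case: (J0 _ iJ); rewrite eqxx.
have Ji1 : i1 \in J = false.
  by apply/negP => iJ; case: (J0 _ iJ) => _; rewrite eqxx.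
have e_in : e = i1 \/ e \in J.
  rewrite /e; case: (m) @J J0 Ji0 Ji1 {m_min sm_end} => [|m'] J *; first by left.
  by right; apply/imsetP; exists ord_max.
have se : s e = i0 \/ s e = i1 by case/orP: sm_end => /eqP; [left|right].
have sJ i : i = i1 \/ i \in J -> i = e \/ s i \in J.
  case=> [->|/imsetP[j _ ->]].
    rewrite /e; case: (m) @J {J0 Ji0 Ji1 e_in se m_min sm_end} => [|m'] J.
      by left.
    by right; apply/imsetP; exists ord0.
  have := ltn_ord j; rewrite leq_eqVlt => /orP[/eqP jm|jm].
    by left; apply: (congr1 (fun k => iter k s i1) jm).
  by right; apply/imsetP; exists (Ordinal jm).
have JV i : i \in J -> s^-1%g i = i1 \/ s^-1%g i \in J.
  case/imsetP=> -[[|j] jm] _ ->; rewrite iterS permK; first by left.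
  by right; apply/imsetP; exists (Ordinal (ltnW jm)).
(* [l] is the one of [i0], [i1] at which the walk does not end. *)
pose l := if s e == i0 then i1 else i0.
have l_end : l = i0 \/ l = i1 by rewrite /l; case: ifP; [right|left].
have l_se : l <> s e.
  rewrite /l; case: eqP => [->|ne] i10; last by case: ne.
  by rewrite i10 eqxx in i01.
(* The values at [i1] are forced: all other indices leave only [e] free for [fp] and only [s^-1 l]
   for [fq]. *)
pose fp i := if i == i1 then e else if i \in J then s^-1%g i else i.
pose fq i := if i == i0 then i1 else if i == i1 then s^-1%g l
             else if i \in J then i else s^-1%g i.
have fp_inj : injective fp.
  have e_J j : j \in J -> e <> s^-1%g j.
    move=> jJ ej; have := J0 _ jJ; rewrite -[j](permKV s) -ej.
    by case: se => ->; rewrite eqxx => -[].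
  have e_out j : j != i1 -> j \notin J -> e <> j.
    by move=> j1 jJ ej; case: e_in; rewrite ej ?(negPf jJ) // => /eqP/(negP j1).
  have J_out j k : j \in J -> k != i1 -> k \notin J -> s^-1%g j <> k.
    move=> jJ k1 kJ jk; case: (JV _ jJ); rewrite jk ?(negPf kJ) //.
    by move/eqP/(negP k1).
  move=> i j; rewrite /fp.
  case: (eqVneq i i1) => [->|i1']; case: (eqVneq j i1) => [->|j1'] //;
    case: ifPn => iJ; try (case: ifPn => jJ); move=> eij //.
  - by case: (e_J _ iJ).
  - by case: (e_out _ j1' iJ).
  - by case: (e_J _ iJ).
  - by case: (e_out _ i1' iJ).
  - exact: perm_inj eij.
  - by case: (J_out _ _ iJ j1' jJ).
  - by case: (J_out _ _ jJ i1' iJ).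
have fq_inj : injective fq.
  have l_K j : j = i1 \/ j \in J -> j <> s^-1%g l.
    move=> jK jl; case: (sJ _ jK) => [je|].
      by apply: l_se; rewrite -je jl permKV.
    by rewrite jl permKV; case: l_end => ->; rewrite ?Ji0 ?Ji1.
  have K_out j k : j = i1 \/ j \in J -> k != i0 -> k != i1 -> k \notin J ->
      j <> s^-1%g k.
    move=> jK k0 k1 kJ jk; have sj : s j = k by rewrite jk permKV.
    case: (sJ _ jK) => [je|]; last by rewrite sj (negPf kJ).
    by case: se; rewrite -je sj => kE; rewrite kE eqxx in k0 k1.
  have l_out k : k != i0 -> k != i1 -> s^-1%g l <> s^-1%g k.
    move=> k0 k1 /perm_inj lk.
    by case: l_end; rewrite lk => kE; rewrite kE eqxx in k0 k1.
  move=> i j; rewrite /fq.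
  case: (eqVneq i i0) => [->|i0']; case: (eqVneq j i0) => [->|j0'] //.
  - case: ifP => [/eqP->|/negbT j1']; first by move/l_K; case; left.
    case: ifPn => [jJ eij|jJ]; first by rewrite -eij Ji1 in jJ.
    by move/K_out; case=> //; left.
  - case: ifP => [/eqP->|/negbT i1']; first by move/esym/l_K; case; left.
    case: ifPn => [iJ eij|iJ]; first by rewrite eij Ji1 in iJ.
    by move/esym/K_out; case=> //; left.
  case: (eqVneq i i1) => [->|i1']; case: (eqVneq j i1) => [->|j1'] //.
  - case: ifPn => [jJ /esym/l_K|_ /l_out]; first by case; right.
    by case.
  - case: ifPn => [iJ /l_K|_ /esym/l_out]; first by case; right.
    by case.
  case: ifPn => iJ; case: ifPn => jJ //.
  - by move/K_out; case=> //; right.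
  - by move/esym/K_out; case=> //; right.
  - exact: perm_inj.
exists (perm fp_inj), (perm fq_inj); split; rewrite ?permE /fp /fq ?eqxx //.
  by rewrite (negPf i01) Ji0.
move=> i i0' i1'; rewrite (permE fp_inj) (permE fq_inj) /fp /fq.
rewrite (negPf i0') (negPf i1').
by case: ifP; rewrite permKV; [right|left].
Qed.

Lemma perm_of_enum (I : finType) (G : finType) (x : I -> G) (f : G -> G) :
  bijective x -> injective f ->
  exists t : {perm I}, forall i, x (t i) = f (x i).
Proof.
case=> y xK yK f_inj.
have inj : injective (fun i => y (f (x i))).
  by move=> i j /(can_inj yK)/f_inj/(can_inj xK).
by exists (perm inj) => i; rewrite permE yK.
Qed.

Lemma exchange_sums (I : finType) (G : finZmodType) (x : I -> G)
    (p q : {perm I}) (i0 i1 : I) (v : G) : bijective x -> i0 != i1 ->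
  exists p' q' : {perm I}, x (p' i0) + x (q' i0) = v /\
    forall i, i != i0 -> i != i1 -> x (p' i) + x (q' i) = x (p i) + x (q i).
Proof.
move=> x_bij i01; pose c := v - x (p i0) - x (p i1).
have [t tE] := perm_of_enum x_bij (addIr c).
pose q1 := (q * t^-1)%g.
have q1E i : x (q i) = x (q1 i) + c by rewrite -tE permM permKV.
(* With [s := p * q1^-1] one has [q1 i = p (s^-1 i)], so reading indices through [p] turns the pair
   [{p i, q1 i}] into the edge [{i, s^-1 i}]. The new sum at [i0] is
   [x (p i0) + x (p i1) + c = v]. *)
have [P [Q [Pi0 Qi0 PQ]]] := reorient_cycles (p * q1^-1)%g i01.
exists (P * p)%g, (Q * p * t)%g; split.
  by rewrite !permM tE Pi0 Qi0 !subrKC.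
have ps i j : (p * q1^-1)%g j = i -> p j = q1 i.
  by move=> <-; rewrite permM permKV.
move=> i i0' i1'; rewrite !permM tE q1E.
by case: (PQ i i0' i1') => [[-> /ps ->]|[/ps -> ->]]; rewrite // addrCA.
Qed.

(** Negation permutes [G], so the sum of all elements is its own opposite. *)
Lemma double_sum_group (I : finType) (G : finZmodType) (x : I -> G) :
  bijective x -> \sum_i x i + \sum_i x i = 0.
Proof.
move=> x_bij; have [t tE] := perm_of_enum x_bij (@oppr_inj G).
rewrite [X in X + _](reindex_perm t) /=; under eq_bigr do rewrite tE.
by rewrite sumrN addNr.
Qed.

(** One index [i1] is never corrected: it absorbs the error of every exchange, and its own value
    comes out right at the end because both families have total sum 0. *)
Lemma hall_abelian (I : finType) (G : finZmodType) (x : I -> G) (d : I -> G) :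
  bijective x -> \sum_i d i = 0 ->
  exists p q : {perm I}, forall i, x (p i) + x (q i) = d i.
Proof.
move=> x_bij d0; case: (pickP (@predT I)) => [i1 _ | I0]; last first.
  by exists 1%g, 1%g => i; have := I0 i.
have [p [q pqE]] : exists p q : {perm I},
    forall i, i \in enum I -> i != i1 -> x (p i) + x (q i) = d i.
  elim: (enum I) => [|j r [p [q IHr]]]; first by exists 1%g, 1%g.
  have [-> | ji1] := eqVneq j i1.
    by exists p, q => i; rewrite inE => /predU1P[-> /eqP|]; [|apply: IHr].
  have [p' [q' [pqj pqr]]] := exchange_sums p q (d j) x_bij ji1.
  exists p', q' => i ijr ii1; have [-> // | ij] := eqVneq i j.
  by rewrite pqr // IHr //; move: ijr; rewrite inE (negPf ij).
exists p, q => i; have [-> | ii1] := eqVneq i i1; last by rewrite pqE ?mem_enum.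
have sum_pq : \sum_i (x (p i) + x (q i)) = 0.
  have sum_perm (r : {perm I}) : \sum_i x (r i) = \sum_i x i.
    by rewrite [RHS](reindex_perm r).
  by rewrite big_split /= !sum_perm double_sum_group.
move: sum_pq; rewrite -[RHS]d0 (bigD1 i1) //= [RHS](bigD1 i1) //=.
by rewrite (eq_bigr d) => [/addIr //|j ji1]; rewrite pqE ?mem_enum.
Qed.

Lemma extended_enum_lift (G : finZmodType) n (n_gt0 : (0 < n)%N)
    (x : 'I_n -> G) i : extended_enum n_gt0 x (lift ord_max i) = x i.
Proof. by rewrite /extended_enum liftK. Qed.

Lemma extended_enum_max (G : finZmodType) n (n_gt0 : (0 < n)%N)
    (x : 'I_n -> G) :
  extended_enum n_gt0 x ord_max = x (Ordinal n_gt0).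
Proof. by rewrite /extended_enum unlift_none. Qed.

Lemma extended_hall (G : finZmodType) n (n_gt0 : (0 < n)%N)
    (x : 'I_n -> G) (c : 'I_n.+1 -> G) :
  bijective x -> x (Ordinal n_gt0) = 0 -> \sum_i c i = 0 ->
  exists p q : 'S_n.+1, forall i,
    extended_enum n_gt0 x (p i) + extended_enum n_gt0 x (q i) = c i.
Proof.
move=> x_bij x0 c0; pose i0 := Ordinal n_gt0; pose L := lift (@ord_max n).
pose d i := c (L i) + (if i == i0 then c ord_max else 0).
have d0 : \sum_i d i = 0.
  rewrite big_split /= -big_mkcond big_pred1_eq -[RHS]c0.
  by rewrite [RHS](bigD1_ord ord_max) //= addrC.
have [p [q pqE]] := hall_abelian x_bij d0.
(* Translating by [w] makes the left summand at [i0] equal to [c (L i0)], which leaves [c ord_max]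
   for the right one. *)
pose w := c (L i0) - x (p i0).
have [t tE] := perm_of_enum x_bij (addIr w).
have [u uE] := perm_of_enum x_bij (addIr (- w)).
exists (lift_perm ord_max ord_max (p * t)).
(* The transposition separates the two summands at [i0]: the left one stays at [L i0], the right one
   moves to [ord_max], and each is paired with the zero of index [ord_max]. *)
exists (tperm (L i0) ord_max * lift_perm ord_max ord_max (q * u))%g => i.
rewrite permM; case: (unliftP ord_max i) => [j|] ->; last first.
  rewrite tpermR !lift_perm_id lift_perm_lift extended_enum_max x0.
  rewrite extended_enum_lift permM uE add0r /w opprB addrA [_ + x (p i0)]addrC pqE /d eqxx.
  by rewrite addrAC subrr add0r.
have [-> | ji0] := eqVneq j i0.
  rewrite tpermL lift_perm_id lift_perm_lift extended_enum_max x0.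
  by rewrite extended_enum_lift permM tE addr0 /w subrKC.
rewrite tpermD ?neq_lift // ?(inj_eq lift_inj) 1?eq_sym //.
rewrite !lift_perm_lift !extended_enum_lift !permM tE uE addrACA subrr addr0.
by rewrite pqE /d (negPf ji0) addr0.
Qed.


Lemma variable_ofE (C : nzRingType) (G : finZmodType) n (x : 'I_n -> G) i :
  injective x -> variable_of C x (x i) = 'X_i.
Proof.
move=> x_inj; rewrite /variable_of; case: pickP => [j /eqP/x_inj-> // | none].
by have := none i; rewrite eqxx.
Qed.

(** Every entry is a single variable, so each permutation contributes one monomial with coefficient
    1. *)
Lemma mcoeff_extended_permanent (C : nzRingType) (G : finZmodType) n
    (n_gt0 : (0 < n)%N) (x : 'I_n -> G) (y : G -> 'I_n) (k : 'X_{1..n}) :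
  cancel x y -> cancel y x ->
  let e := extended_enum n_gt0 x in
  (permanent (extended_cayley_table C n_gt0 x))@_k =
  #|[set s : 'S_n.+1 | (\sum_i U_(y (e i + e (s i))%R))%MM == k]|%:R.
Proof.
move=> xK yK e; rewrite -sum1_card natr_sum big_mkcond raddf_sum /=.
apply: eq_bigr => s _; rewrite inE.
rewrite (eq_bigr (fun i => 'X_[U_(y (e i + e (s i))%R)])) => [|i _].
  by rewrite mprodXE mcoeffX; case: eqP.
by rewrite mxE -[X in variable_of _ _ X]yK (variable_ofE _ _ (can_inj xK)).
Qed.

Lemma sum_mulr_mnm (V : nmodType) n (x : 'I_n -> V) m (f : 'I_m -> 'I_n) :
  \sum_i x i *+ (\sum_j U_(f j))%MM i = \sum_j x (f j).
Proof.
rewrite (eq_bigr (fun i => \sum_j x i *+ U_(f j)%MM i)) => [|i _]; last first.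
  by rewrite mnm_sumE -sumrMnr.
rewrite exchange_big; apply: eq_bigr => j _.
rewrite (bigD1 (f j)) //= mnm1E eqxx big1 ?addr0 // => i ij.
by rewrite mnm1E eq_sym (negPf ij).
Qed.

(** Listing the variables with multiplicity, as [m2s] does, turns an exponent vector into an indexed
    family to which [extended_hall] can be applied. *)
Lemma mnm_sum_mnm1 n m (k : 'X_{1..n}) : mdeg k = m ->
  exists f : 'I_m -> 'I_n, k = (\sum_j U_(f j))%MM.
Proof.
move=> km; have sz : size (m2s k) == m by rewrite size_m2s km.
exists (tnth (Tuple sz)); apply/mnmP => i.
rewrite -{1}[k]s2mK mnmE mnm_sumE -sum1_count big_mkcond.
rewrite (big_tuple _ _ (Tuple sz)).
by apply: eq_bigr => j _; rewrite mnm1E /=; case: eqP.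
Qed.

Theorem theorem5p8 (R : realType) (G : finZmodType) (n : nat)
    (n_gt0 : (0 < n)%N) (x : 'I_n -> G) (x_bij : bijective x)
    (x0 : x (Ordinal n_gt0) = 0) (k : 'X_{1..n}) :
  (permanent (extended_cayley_table R[i] n_gt0 x))@_k != 0
  <-> (\sum_(i < n) k i)%N = n.+1 /\ \sum_(i < n) x i *+ k i = 0.
Proof.
have [y xK yK] := x_bij; rewrite (mcoeff_extended_permanent _ _ _ xK yK).
set e := extended_enum n_gt0 x; rewrite Num.Theory.pnatr_eq0 cards_eq0 -mdegE.
split=> [/set0Pn[s] | [/mnm_sum_mnm1[f ->]]].
  rewrite inE => /eqP <-; split.
    rewrite mdeg_sum (eq_bigr (fun _ => 1%N)) => [|i _]; last exact: mdeg1.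
    by rewrite big_const_ord iter_addn addn0 mul1n.
  rewrite sum_mulr_mnm; under eq_bigr do rewrite yK.
  (* The total does not depend on [s], and the repeated element adds 0 to it. *)
  have -> : \sum_i (e i + e (s i)) = \sum_i e i + \sum_i e i.
    by rewrite big_split; congr (_ + _); rewrite [RHS](reindex_perm s).
  rewrite (bigD1_ord ord_max) //= /e extended_enum_max x0 add0r.
  rewrite (eq_bigr x) => [|i _]; last exact: extended_enum_lift.
  exact: double_sum_group.
rewrite sum_mulr_mnm => /(extended_hall x_bij x0)[p [q pqE]].
(* This permutation sends [p i] to [q i], so reindexing along [p] recovers the sums
   [e (p i) + e (q i)]. *)
apply/set0Pn; exists (p^-1 * q)%g; rewrite inE; apply/eqP.
rewrite (reindex_perm p) /=; apply: eq_bigr => i _.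
by rewrite permM permK pqE xK.
Qed.
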